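(* Let $\mathbf b\in\mathbb{Z}^{n}$ be an integer vector indexed by $V(G)$, and for a positive integer $q$ let $b=[\mathbf b]_q:V(G)\to\mathbb{Z}_q$. The following hold. (1) For every positive integer $q$, $$\#F^*(G,b;\mathbb{Z}_q)=\sum_{S\subseteq E(G)}(-1)^{|S|}\tilde{d}_S(q)\,q^{m(G-S)}.$$ Moreover, there exists a polynomial $\tau(G,b;t)$ (depending on $G$, its orientation and $\mathbf b$) such that $\#F^*(G,b;\mathbb{Z}_q)=\tau(G,b;q)$ for all integers $q>q_{\mathbf b}$, and $\tau(G,b;t)$ can be written as $$\tau(G,b;t)=\sum_{S\subseteq E(G),\ r(\bar{M}_S)=m-m(G-S)}(-1)^{|S|}t^{m(G-S)}.$$ (2) $\tau(G,b;t)=\chi\big(\mathcal{A}_{E(G)}^{(M_G,\mathbf b)},t\big)$. (3) For any positive integers $p,q$, with $b=[\mathbf b]_q$ and $b'=[\mathbf b]_{pq}$, if $G$ has a $(\mathbb{Z}_{pq},b')$-flow, then $$\#F^*(G,b;\mathbb{Z}_q)\le \#F^*(G,b';\mathbb{Z}_{pq}).$$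
   Context: $G$ is a finite graph, multiple edges and loops allowed, with vertex set $V(G)=\{1,\dots,n\}$ and $m=|E(G)|$ edges, equipped with a fixed orientation. For $S\subseteq E(G)$, $G-S$ is the spanning subgraph obtained by removing the edges in $S$; $c(\cdot)$ is the number of connected components; the nullity of a spanning subgraph with edge set $T$ is $|T|-|V(G)|+c$, and $m(G-S)$ denotes the nullity of $G-S$ (not to be confused with the integer $m=|E(G)|$). $\mathbb{Z}_q=\mathbb{Z}/q\mathbb{Z}$ and $[\cdot]_q$ denotes entrywise reduction modulo $q$. For $b:V(G)\to\mathbb{Z}_q$, a $(\mathbb{Z}_q,b)$-flow of $G$ is $f:E(G)\to\mathbb{Z}_q$ with $\sum_{e\in E^+(v)}f(e)-\sum_{e\in E^-(v)}f(e)=b(v)$ for all $v\in V(G)$, where $E^+(v)$ (resp. $E^-(v)$) is the set of edges with head (resp. tail) $v$. It is nowhere-zero if $f(e)\ne0$ for all $e\in E(G)$. $F^*(G,b;\mathbb{Z}_q)$ is the set of nowhere-zero $(\mathbb{Z}_q,b)$-flows. The incidence matrix $M_G=(m_{ve})$ is the $n\times m$ matrix with $m_{ve}=1$ if $e$ is a non-loop edge with head $v$, $-1$ if $e$ is a non-loop edge with tail $v$, and $0$ otherwise. Let $I$ be the $m\times m$ identity matrix with rows and columns indexed by $E(G)$, $I_S$ its submatrix of rows indexed by $S$, and $\bar M_S=\begin{bmatrix}M_G&\mathbf b\\ I_S&\mathbf 0\end{bmatrix}$. $r(\cdot)$ of a matrix is its rank, and for an integer matrix $N$ of positive rank, $d(N)$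 is its largest invariant factor (the last nonzero diagonal entry of its Smith normal form, taken positive). Put $$q_{\mathbf b}=\max\{d(\bar M_S): S\subseteq E(G),\ r(\bar M_S)\ne m-m(G-S)\}$$ (with $q_{\mathbf b}=0$ if there is no such $S$). Let $\tilde d_S(q)=1$ if $r(\bar M_S)=m-m(G-S)$; $\tilde d_S(q)=1$ if $r(\bar M_S)\ne m-m(G-S)$ and $d(\bar M_S)\equiv0\pmod q$; and $\tilde d_S(q)=0$ otherwise. $\mathcal{A}_{E(G)}^{(M_G,\mathbf b)}$ is the arrangement, in $V(M_G,\mathbf b)=\{\mathbf x\in\mathbb{R}^{E(G)}:M_G\mathbf x=\mathbf b\}$, of the subspaces $H_e=\{\mathbf x\in V(M_G,\mathbf b):x_e=0\}$, $e\in E(G)$. Its characteristic polynomial is $\chi\big(\mathcal{A}_{E(G)}^{(M_G,\mathbf b)},t\big)=\sum_S(-1)^{|S|}t^{\dim(\bigcap_{e\in S}H_e)}$, the sum over $S\subseteq E(G)$ with $\bigcap_{e\in S}H_e\neq\emptyset$ (the intersection for $S=\emptyset$ being $V(M_G,\mathbf b)$); it is the zero polynomial if $V(M_G,\mathbf b)=\emptyset$. *)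

(* Defs.v *)
From HB Require Import structures.
From mathcomp Require Import all_boot all_order all_algebra.
From mathcomp Require Import boolp classical_sets reals.

Set Implicit Arguments.
Unset Strict Implicit.
Unset Printing Implicit Defensive.

Import Order.TTheory GRing.Theory Num.Theory.

Local Open Scope ring_scope.

(* Oriented multigraphs with vertex set 'I_n and edge set 'I_m; an edge e with
   tail e = head e is a loop. *)
Record multigraph (n m : nat) := Multigraph {
  tail : 'I_m -> 'I_n;
  head : 'I_m -> 'I_n
}.

(* Z/qZ for q > 0, including the trivial group for q = 1 (whereas 'Z_1 denotes
   Z/2Z). Only the additive structure is needed. *)
Definition Zmod (q : nat) : finZmodType := 'I_(q.-1.+1).

Definition redz (q : nat) (z : int) : Zmod q :=
  inZp `|(z %% (q.-1.+1)%:Z)%Z|%N.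

Section Graph.

Variables (n m : nat) (G : multigraph n m).
Implicit Types (S T : {set 'I_m}) (b : 'cV[int]_n).

(* Adjacency in the spanning subgraph with edge set T, orientation ignored. *)
Definition adj T : rel 'I_n := fun u v =>
  [exists e in T, (tail G e == u) && (head G e == v)
               || (tail G e == v) && (head G e == u)].

Definition num_components T : nat := n_comp (adj T) 'I_n.

(* The subtraction is never truncated: n <= #|T| + num_components T. *)
Definition nullity T : nat := (#|T| + num_components T - n)%N.

(* The nullity m(G - S) of G - S. *)
Definition co_nullity S : nat := nullity (~: S).

Definition is_flow (A : finZmodType) (b : 'I_n -> A) (f : {ffun 'I_m -> A}) :=
  [forall v, \sum_(e | head G e == v) f e - \sum_(e | tail G e == v) f e
             == b v].

Definition nz_flows (A : finZmodType) (b : 'I_n -> A) : {set {ffun 'I_m -> A}} :=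
  [set f | is_flow b f && [forall e, f e != 0]].

Definition incidence : 'M[int]_(n, m) := \matrix_(v, e)
  if head G e == tail G e then 0
  else if head G e == v then 1
  else if tail G e == v then -1
  else 0.

Definition id_rows S : 'M[int]_(#|S|, m) :=
  rowsub (fun i : 'I_#|S| => enum_val i) 1%:M.

Definition bar_mx b S : 'M[int]_(n + #|S|, m + 1) :=
  block_mx incidence b (id_rows S) 0.

End Graph.

Definition rank_int (k l : nat) (N : 'M[int]_(k, l)) : nat :=
  \rank (map_mx (intr : int -> rat) N).

(* The diagonal of a Smith normal form of N, up to the signs of its entries. *)
Definition smith_diag (k l : nat) (N : 'M[int]_(k, l)) : seq int :=
  let: existT2 _ _ (existT2 _ _ (exist2 d _ _)) := int_Smith_normal_form N in
  [seq d`_i | i <- iota 0 (minn k l)].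

Lemma smith_diagP (k l : nat) (N : 'M[int]_(k, l)) :
  [/\ size (smith_diag N) = minn k l,
      sorted dvdz (smith_diag N) &
      exists L, exists R, [/\ L \in unitmx, R \in unitmx &
        N = L *m (\matrix_(i, j) ((smith_diag N)`_i *+ (i == j :> nat))) *m R]].
Proof.
rewrite /smith_diag; case: int_Smith_normal_form => L Lu [R Ru [d sd defN]].
split; first by rewrite size_map size_iota.
- have dvd0 i : dvdz d`_i d`_i.+1.
    have [ltid | leid] := ltnP i.+1 (size d).
      by move/(sortedP 0): sd; apply.
    by rewrite [d`_i.+1]nth_default // /dvdz /= dvdn0.
  apply/(sortedP 0) => i; rewrite size_map size_iota => lti.
  rewrite !(nth_map 0%N) ?size_iota ?(ltnW lti) //.
  by rewrite !nth_iota ?(ltnW lti) // !add0n; apply: dvd0.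
exists L, R; split=> //; rewrite [LHS]defN; congr (_ *m _ *m _).
apply/matrixP=> i j; rewrite !mxE; case: eqP => //= eqij.
have ltim : (i < minn k l)%N by rewrite leq_min ltn_ord eqij ltn_ord.
by rewrite (nth_map 0%N) ?size_iota // nth_iota // add0n.
Qed.

(* The value is 0 when N = 0. *)
Definition last_inv_factor (k l : nat) (N : 'M[int]_(k, l)) : nat :=
  `|last 0%R [seq x <- smith_diag N | x != 0%R]|%N.

Section Thresholds.

Variables (n m : nat) (G : multigraph n m) (b : 'cV[int]_n).
Implicit Type S : {set 'I_m}.

(* The subtraction is never truncated: co_nullity G S <= m. *)
Definition rank_cond S : bool :=
  rank_int (bar_mx G b S) == (m - co_nullity G S)%N.

Definition q_bound : nat :=
  \max_(S : {set 'I_m} | ~~ rank_cond S) last_inv_factor (bar_mx G b S).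

Definition tilde_d S (q : nat) : nat :=
  if rank_cond S then 1%N
  else if (q %| last_inv_factor (bar_mx G b S))%N then 1%N
  else 0%N.

End Thresholds.

Section Arrangement.

Local Open Scope classical_set_scope.

Variables (R : realType) (n m : nat).
Implicit Types (M : 'M[int]_(n, m)) (b : 'cV[int]_n) (S : {set 'I_m}).

(* The dimension of a nonempty affine subspace A = x + U is that of the vector
   space U; the value is 0 if A is not of this form. *)
Definition aff_dim (A : set 'cV[R]_m) : nat :=
  xget 0%N [set k | exists (x : 'cV[R]_m) (U : {vspace 'cV[R]_m}),
    A = [set x + u | u in [set` U]] /\ \dim U = k].

Definition ambient M b : set 'cV[R]_m :=
  [set x | map_mx intr M *m x = map_mx intr b].

Definition hyper M b (e : 'I_m) : set 'cV[R]_m :=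
  [set x | ambient M b x /\ x e 0 = 0].

Definition flat M b S : set 'cV[R]_m :=
  ambient M b `&` \bigcap_(e in [set` S]) hyper M b e.

Definition char_poly_arr M b : {poly int} :=
  \sum_(S : {set 'I_m} | `[< flat M b S !=set0 >])
     (-1) ^+ #|S| *: 'X^(aff_dim (flat M b S)).

End Arrangement.

(* Main.v *)
Require Import Defs.
From HB Require Import structures.
From mathcomp Require Import all_boot all_order all_algebra.
From mathcomp Require Import boolp classical_sets reals.
From mathcomp Require Import zify.
(* Otherwise [head] would be [seq.head]. *)
Import Defs.

Set Implicit Arguments.
Unset Strict Implicit.
Unset Printing Implicit Defensive.

Import Order.TTheory GRing.Theory Num.Theory.

Local Open Scope ring_scope.

(* Flows vanishing on [S] are the solutions of [A x = c], where [A] stacks the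
   incidence matrix on the rows of the identity indexed by [S] and [c] is [b]
   padded with zeros. The left kernel of [A] over any field is spanned by the
   indicators of the components of [G - S], so the rank of [A] does not depend
   on the field; hence the invariant factors of [A] are units, [A] has an
   integral generalized inverse [W] (that is, [A W A = A]) and its integral
   kernel is a direct summand with basis [B], of rank [m(G - S)]. Solvability
   of [A x = c] over the integers, the rationals or the reals is then the single
   condition [A W c = c], and every solution modulo [q] of the homogeneous
   system lifts to an integral one, so a solvable system has [q ^ m(G - S)] solutions
   modulo [q]. If [A x = c] has no rational solution, the column lattice of [A]
   being saturated, the torsion of the cokernel of [A c] is cyclic of order
   [d(A c)] and the system is solvable modulo [q] iff [q] divides [d(A c)].
   Inclusion-exclusion over [S] gives (1); over the reals the same condition
   decides which flats are nonempty and [B] spans their direction, which gives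
   (2); (3) is the lifting of homogeneous solutions. *)

(** * Rank of the flow matrix over an arbitrary field *)

Section IncidenceRank.

Variables (n m : nat) (G : multigraph n m).
Implicit Types S T : {set 'I_m}.

Definition flow_mx S : 'M[int]_(n + #|S|, m) :=
  col_mx (incidence G) (id_rows S).

(** A loop is counted twice with opposite signs, which absorbs its special case in [incidence]. *)
Lemma incidenceE v e :
  incidence G v e = (head G e == v)%:R - (tail G e == v)%:R.
Proof.
rewrite mxE; case: (head G e =P tail G e) => [->|ht]; first by rewrite subrr.
case: (head G e =P v) => [<-|_]; last by case: eqP; rewrite ?sub0r ?oppr0.
by case: eqP => [th|]; [case: ht | rewrite subr0].
Qed.

Lemma adj_sym T : symmetric (adj G T).
Proof. by move=> u v; apply: eq_existsb => e; rewrite orbC. Qed.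

Lemma adj_connect_sym T : connect_sym (adj G T).
Proof. exact/sym_connect_sym/adj_sym. Qed.

Variable F : fieldType.

Let MF : 'M[F]_(n, m) := map_mx intr (incidence G).

Let IF S : 'M[F]_(#|S|, m) := map_mx intr (id_rows S).

Let IFE S i e : IF S i e = (enum_val i == e)%:R.
Proof. by rewrite !mxE; case: eqP. Qed.

Let row_incidence p (x : 'M[F]_(p, n)) i e :
  (x *m MF) i e = x i (head G e) - x i (tail G e).
Proof.
rewrite !mxE (eq_bigr (fun v =>
  x i v * (head G e == v)%:R - x i v * (tail G e == v)%:R)); last first.
  by move=> v _; rewrite [MF _ _]mxE incidenceE rmorphB !rmorph_nat mulrBr.
rewrite big_split sumrN /=; congr (_ - _).
  rewrite (bigD1 (head G e)) //= eqxx mulr1 big1 ?addr0 // => v.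
  by rewrite eq_sym => /negPf->; rewrite mulr0.
rewrite (bigD1 (tail G e)) //= eqxx mulr1 big1 ?addr0 // => v.
by rewrite eq_sym => /negPf->; rewrite mulr0.
Qed.

Let IF_tr S : IF S *m (IF S)^T = 1%:M.
Proof.
apply/matrixP => i j; rewrite !mxE (bigD1 (enum_val i)) //= big1 => [|e ne].
  by rewrite [X in _ * X]mxE !IFE eqxx mul1r addr0 (inj_eq enum_val_inj) eq_sym.
by rewrite IFE eq_sym (negPf ne) mul0r.
Qed.

Let tr_IF p S (y : 'M[F]_(p, m)) i e :
  (y *m ((IF S)^T *m IF S)) i e = y i e * (e \in S)%:R.
Proof.
rewrite !mxE (bigD1 e) //= big1 => [|e' ne]; last first.
  rewrite mxE big1 ?mulr0 // => k _.
  rewrite [_^T _ _]mxE !IFE; case: eqP => [->|]; last by rewrite mul0r.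
  by rewrite (negPf ne) mulr0.
rewrite addr0 mxE; congr (_ * _).
case: (boolP (e \in S)) => [eS|eS].
  rewrite (bigD1 (enum_rank_in eS e)) //= [_^T _ _]mxE !IFE enum_rankK_in // eqxx.
  rewrite mulr1 big1 ?addr0 // => k nk; rewrite [_^T _ _]mxE !IFE.
  case: eqP => [ek|]; last by rewrite mul0r.
  by case/eqP: nk; apply: enum_val_inj; rewrite enum_rankK_in.
rewrite big1 // => k _; rewrite [_^T _ _]mxE !IFE.
case: eqP => [ek|]; last by rewrite mul0r.
by case/negP: eS; rewrite -ek enum_valP.
Qed.

(** The rows are the indicators of the components, each named by its root; [rep_mx] evaluates at the
    roots. *)
Let comp_mx T : 'M[F]_(num_components G T, n) :=
  \matrix_(i, v) (fingraph.root (adj G T) v == enum_val i)%:R.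

Let rep_mx T : 'M[F]_(n, num_components G T) :=
  \matrix_(v, i) (v == enum_val i)%:R.

Let comp_rep T : comp_mx T *m rep_mx T = 1%:M.
Proof.
apply/matrixP => i j; rewrite !mxE (bigD1 (enum_val j)) //= big1 => [|v nv].
  rewrite !mxE eqxx mulr1 addr0; have := enum_valP j.
  rewrite inE => /andP[/eqP-> _].
  by rewrite (inj_eq enum_val_inj) eq_sym.
by rewrite !mxE (negPf nv) mulr0.
Qed.

Let rep_comp T p (x : 'M[F]_(p, n)) i v :
  (x *m rep_mx T *m comp_mx T) i v = x i (fingraph.root (adj G T) v).
Proof.
have rP : fingraph.root (adj G T) v \in predI (roots (adj G T)) (mem 'I_n).
  by rewrite inE /= andbT; apply/roots_root/adj_connect_sym.
rewrite mxE (bigD1 (enum_rank_in rP (fingraph.root (adj G T) v))) //= big1 => [|k nk].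
  rewrite mxE [X in _ * X]mxE enum_rankK_in // eqxx mulr1 addr0.
  rewrite (bigD1 (fingraph.root (adj G T) v)) //= big1 => [|w nw].
    by rewrite mxE enum_rankK_in // eqxx mulr1 addr0.
  by rewrite mxE enum_rankK_in // (negPf nw) mulr0.
rewrite [X in _ * X]mxE; case: eqP => [ek|]; last by rewrite mulr0.
by case/eqP: nk; apply: enum_val_inj; rewrite enum_rankK_in.
Qed.

(* The rows of [comp_mx T *m E] form a basis of the left kernel. *)
Lemma mxrank_flow_mx S :
  (\rank (map_mx intr (flow_mx S) : 'M[F]_(_, _)) + num_components G (~: S)
     = n + #|S|)%N.
Proof.
set A := map_mx _ _; set T := ~: S.
(* As [IF S *m (IF S)^T] is the identity, a left kernel vector with vertex part [x] must have
   [- x *m MF *m (IF S)^T] as its part on [S]; [E] appends that part. *)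
pose E : 'M[F]_(n, n + #|S|) := row_mx 1%:M (- (MF *m (IF S)^T)).
have defA : A = col_mx MF (IF S) by rewrite /A map_col_mx.
have EA : E *m A = MF - MF *m ((IF S)^T *m IF S).
  by rewrite defA mul_row_col mul1mx mulNmx mulmxA.
have KA : comp_mx T *m E *m A = 0.
  apply/matrixP => i e; rewrite -mulmxA EA mulmxBr !mulmxA -[_ *m _ *m IF S]mulmxA.
  rewrite mxE [X in _ + X]mxE tr_IF row_incidence [RHS]mxE.
  case: (boolP (e \in S)) => [|eS]; first by rewrite mulr1 subrr.
  rewrite mulr0 subr0 [X in X - _]mxE [X in _ - X]mxE.
  suff -> : fingraph.root (adj G T) (head G e)
          = fingraph.root (adj G T) (tail G e) by rewrite subrr.
  apply/(fingraph.rootP (adj_connect_sym T))/connect1/existsP; exists e.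
  by rewrite inE eS !eqxx orbT.
have KE : (kermx A <= comp_mx T *m E)%MS.
  set X := kermx A; have XA : X *m A = 0 by apply: mulmx_ker.
  pose x := lsubmx X; pose y := rsubmx X.
  have eXA : x *m MF + y *m IF S = 0.
    by rewrite -mul_row_col -defA hsubmxK.
  have ey : y = - (x *m MF *m (IF S)^T).
    have /eqP := congr1 (mulmx^~ (IF S)^T) eXA.
    by rewrite mul0mx mulmxDl -(mulmxA y) IF_tr mulmx1 addrC addr_eq0 => /eqP.
  have eX : X = x *m E.
    by rewrite mul_mx_row mulmx1 mulmxN mulmxA -ey hsubmxK.
  (* On an edge outside [S] the kernel equation makes [x] agree at both ends, so [x] is constant on
     components and recovered from its values at the roots. *)
  have xT i e : e \in T -> x i (head G e) = x i (tail G e).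
    rewrite inE => eS; have /matrixP/(_ i e) := eXA.
    rewrite ey mulNmx -[_ *m _ *m IF S]mulmxA.
    rewrite mxE [X in _ + X]mxE tr_IF row_incidence (negPf eS) mulr0 subr0.
    rewrite [X in _ = X -> _]mxE.
    exact: subr0_eq.
  have xc i v w : adj G T v w -> x i v = x i w.
    by case/existsP => e /andP[eT] /orP[]/andP[/eqP<- /eqP<-] /=; rewrite xT.
  have xr i v : x i v = x i (fingraph.root (adj G T) v).
    have /connectP[p pP ->] := connect_root (adj G T) v.
    by elim: p v pP => //= w p IHp v /andP[/xc-> /IHp].
  have ex : x = x *m rep_mx T *m comp_mx T.
    by apply/matrixP => i v; rewrite rep_comp.
  by rewrite eX ex -mulmxA submxMl.
have Efree : row_free (comp_mx T *m E).
  apply/row_freeP; exists (col_mx (rep_mx T) 0).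
  by rewrite -mulmxA mul_row_col mul1mx mulmx0 addr0.
have /eqP : \rank (kermx A) = num_components G T.
  apply/eqP; rewrite eqn_leq -{2}(eqP Efree).
  rewrite [X in _ && X]mxrankS; last exact/sub_kermxP.
  by rewrite andbT (leq_trans (mxrankS KE)) // rank_leq_row.
by rewrite mxrank_ker => /eqP <-; rewrite subnKC // rank_leq_row.
Qed.
End IncidenceRank.

(** * Integral splittings from Smith normal forms *)

Lemma dvdz_nth (s : seq int) i j :
  sorted dvdz s -> (i <= j)%N -> (s`_i %| s`_j)%Z.
Proof.
move=> /(sortedP 0) ss; elim: j => [|j IHj]; first by rewrite leqn0 => /eqP->.
rewrite leq_eqVlt => /predU1P[->//|/IHj/dvdz_trans]; apply.
have [/ss // | le_si] := ltnP j.+1 (size s).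
by rewrite [s`_j.+1]nth_default ?dvdz0.
Qed.

Section QuasiDiagonal.

Variable R : nzRingType.

Definition qdiag_mx k l (f : nat -> R) : 'M[R]_(k, l) :=
  \matrix_(i, j) (f i *+ (i == j :> nat)).

Lemma mul_qdiag_mx k l p f g :
  qdiag_mx k l f *m qdiag_mx l p g
    = qdiag_mx k p (fun i => f i * g i *+ (i < l)%N).
Proof.
apply/matrixP => i j; rewrite !mxE.
have [lt_il|le_li] := ltnP i l; last first.
  rewrite mulr0n mul0rn big1 // => h _; rewrite !mxE.
  case: eqP => [ih|]; last by rewrite mulr0n mul0r.
  by have := ltn_ord h; rewrite -ih ltnNge le_li.
rewrite (bigD1 (Ordinal lt_il)) //= big1 => [|h nh].
  by rewrite !mxE /= eqxx !mulr1n addr0 mulrnAr.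
rewrite !mxE; case: eqP => [ih|]; last by rewrite mulr0n mul0r.
by case/eqP: nh; apply/val_inj.
Qed.

Lemma tr_qdiag_mx k l f : (qdiag_mx k l f)^T = qdiag_mx l k f.
Proof. by apply/matrixP => i j; rewrite !mxE eq_sym; case: eqP => // ->. Qed.

End QuasiDiagonal.

Section QuasiDiagonalRank.

Variables (F : fieldType) (k l r : nat) (f : nat -> F).
Hypothesis rank_f : \rank (qdiag_mx k l f) = r.

(** If [f i] were 0, all later entries would vanish too, leaving at most [i] nonzero rows. *)
Lemma qdiag_mx_rank_neq0 i :
  (forall a b, (a <= b)%N -> f a = 0 -> f b = 0) -> (i < r)%N -> f i != 0.
Proof.
move=> f_mono lt_ir; apply/negP => /eqP fi0.
have le_rk : (r <= k)%N by rewrite -rank_f rank_leq_row.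
have eD : qdiag_mx k l f = pid_mx i *m qdiag_mx k l f.
  apply/matrixP => a b; rewrite !mxE (bigD1 a) //= big1 => [|c nc].
    rewrite !mxE eqxx addr0 /=; case: ltnP => [_|le_ia]; first by rewrite mul1r.
    by rewrite (f_mono i a) // mul0rn mulr0.
  rewrite mxE (_ : (a == c :> nat) = false) ?mul0r //.
    by apply: contraNF nc => /eqP/val_inj->.
have := mxrankM_maxl (pid_mx i : 'M[F]_k) (qdiag_mx k l f).
by rewrite -eD rank_f rank_pid_mx ?(leqNgt r) ?lt_ir // (leq_trans (ltnW lt_ir)).
Qed.

(** If [f i] were nonzero, so would be all earlier entries, and inverting them would produce
    [pid_mx i.+1], of rank above [r]. *)
Lemma qdiag_mx_rank_eq0 i :
    (forall a b, (a <= b)%N -> f a = 0 -> f b = 0) ->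
  (r <= i < k)%N -> (i < l)%N -> f i = 0.
Proof.
move=> f_mono /andP[le_ri lt_ik] lt_il; apply/eqP; apply: contraT => fi0.
have fn0 a : (a <= i)%N -> f a != 0.
  by move=> le_ai; apply: contraNneq fi0 => /(f_mono _ _ le_ai) ->.
have := mxrankM_maxr (qdiag_mx k k (fun a => (f a)^-1 *+ (a <= i)%N))
                     (qdiag_mx k l f).
rewrite mul_qdiag_mx rank_f.
suff -> : qdiag_mx k l (fun a => (f a)^-1 *+ (a <= i)%N * f a *+ (a < k)%N)
        = pid_mx i.+1.
  by rewrite rank_pid_mx // leqNgt ltnS le_ri.
apply/matrixP => a b; rewrite !mxE ltn_ord mulr1n ltnS andbC.
case: leqP => [/fn0 fa0|_]; first by rewrite mulr1n mulVf.
by rewrite mul0r mul0rn.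
Qed.

End QuasiDiagonalRank.

Lemma map_qdiag_mx (R : nzRingType) k l (f : nat -> int) :
  map_mx intr (qdiag_mx k l f) = qdiag_mx k l (fun i => (f i)%:~R : R).
Proof. by apply/matrixP => i j; rewrite !mxE rmorphMn. Qed.

(* Reduction modulo every prime divisor shows that the nonzero invariant factors
   of [A] are units. *)
Lemma constant_rank_split k l r d (A : 'M[int]_(k, l)) : (r + d = l)%N ->
    (forall F : fieldType, \rank (map_mx intr A : 'M[F]_(k, l)) = r) ->
  exists (B : 'M[int]_(l, d)) (C : 'M[int]_(d, l)) (W : 'M[int]_(l, k)),
    [/\ A *m B = 0, C *m B = 1%:M & B *m C + W *m A = 1%:M].
Proof.
move=> rd rankA.
have [L Lu [R Ru [s ss defA]]] := int_Smith_normal_form A.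
rewrite -/(qdiag_mx k l (fun i => s`_i)) in defA; set D := qdiag_mx _ _ _ in defA.
have Zu (F : fieldType) p (X : 'M[int]_p) :
    X \in unitmx -> (map_mx intr X : 'M[F]_p) \in unitmx.
  by move=> Xu; rewrite unitmxE det_map_mx rmorph_unit.
have rankD (F : fieldType) : \rank (qdiag_mx k l (fun i => (s`_i)%:~R : F)) = r.
  rewrite -map_qdiag_mx -(rankA F) defA !map_mxM /=.
  rewrite mxrankMfree ?row_free_unit ?Zu //.
  rewrite -[RHS]mxrank_tr trmx_mul mxrankMfree ?mxrank_tr //.
  by rewrite row_free_unit unitmx_tr Zu.
have mono (F : fieldType) a b :
    (a <= b)%N -> (s`_a)%:~R = 0 :> F -> (s`_b)%:~R = 0 :> F.
  move=> /(dvdz_nth ss)/dvdzP[c ->] sa0; by rewrite rmorphM /= sa0 mulr0.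
have s0 i : (r <= i < k)%N -> (i < l)%N -> s`_i = 0.
  move=> ri il; have := qdiag_mx_rank_eq0 (rankD rat) (@mono rat) ri il.
  by move/eqP; rewrite intr_eq0 => /eqP.
(* Unit entries are recorded through their squares, the form in which they occur in [D^T *m D]. *)
have s1 i : (i < r)%N -> s`_i * s`_i = 1.
  move=> lt_ir; have n0 F := qdiag_mx_rank_neq0 (rankD F) (@mono F) lt_ir.
  suff: absz s`_i == 1%N by lia.
  have := n0 rat; rewrite intr_eq0 -absz_gt0 => gt0.
  apply: contraT => n1.
  have gt1 : (1 < absz (s`_i)%R)%N by rewrite ltn_neqAle eq_sym n1.
  have p_pr := pdiv_prime gt1; have := n0 'F_(pdiv (absz s`_i)).
  suff -> : (s`_i)%:~R = 0 :> 'F_(pdiv (absz s`_i)) by rewrite eqxx.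
  apply/eqP; rewrite -(dvdz_pcharf (pchar_Fp p_pr)).
  by rewrite dvdzE; apply: pdiv_dvd.
have le_rk : (r <= k)%N by rewrite -(rankA rat) rank_leq_row.
(* [E] includes the last [d] coordinates, which span the kernel of [D]. *)
pose E : 'M[int]_(l, d) := \matrix_(i, j) (i == r + j :> nat)%N%:R.
have ETE : E^T *m E = 1%:M.
  apply/matrixP => i j; rewrite !mxE.
  have ltl (h : 'I_d) : (r + h < l)%N by rewrite -rd ltn_add2l.
  rewrite (bigD1 (Ordinal (ltl i))) //= big1 => [|h nh].
    by rewrite !mxE /= eqxx mul1r addr0 eqn_add2l.
  by rewrite !mxE (_ : (h == _ :> nat) = false) ?mul0r //; exact: negPf nh.
have DE : D *m E = 0.
  apply/matrixP => i j; rewrite !mxE big1 // => h _; rewrite !mxE.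
  case: (i =P h :> nat) => [ih|]; last by rewrite mul0r.
  case: eqP => [hr|]; last by rewrite mulr0.
  by rewrite (s0 i) ?mul0r // ih ?ltn_ord // hr leq_addr -hr -ih /=.
(* The two terms are the projections onto the last [d] and the first [r] coordinates. *)
have EET : E *m E^T + D^T *m D = 1%:M.
  rewrite tr_qdiag_mx mul_qdiag_mx; apply/matrixP => i j; rewrite !mxE.
  case: (ltnP i r) => [lt_ir|le_ri].
    rewrite big1 => [|h _]; last first.
      by rewrite !mxE (_ : (i == _ :> nat) = false) ?mul0r //; lia.
    by rewrite add0r s1 // (leq_trans lt_ir le_rk) mulr1n.
  have ltd : (i - r < d)%N by have := ltn_ord i; lia.
  rewrite (bigD1 (Ordinal ltd)) //= big1 => [|h nh]; last first.
    rewrite !mxE (_ : (i == _ :> nat) = false) ?mul0r //.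
    by apply: contraNF nh => /eqP ei; apply/eqP/val_inj => /=; rewrite ei addKn.
  rewrite !mxE /= subnKC // eqxx mul1r addr0 [(j == i :> nat)]eq_sym.
  case: (ltnP i k) => [lt_ik|_]; last by rewrite mulr0n mul0rn addr0.
  by rewrite s0 ?le_ri ?ltn_ord // mul0r !mul0rn addr0.
(* The splitting for [D], with [D^T] as generalized inverse, is carried to [A] by [L] and [R]. *)
exists (invmx R *m E), (E^T *m R), (invmx R *m D^T *m invmx L); split.
- by rewrite defA -!mulmxA mulKVmx // DE mulmx0.
- by rewrite -!mulmxA mulKVmx.
rewrite defA -!mulmxA mulKmx // -mulmxDr.
by rewrite (mulmxA E) (mulmxA D^T) -mulmxDl EET mul1mx mulVmx.
Qed.

Lemma split_ginv k l d (A : 'M[int]_(k, l)) (B : 'M_(l, d)) C W :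
  A *m B = 0 -> B *m C + W *m A = 1%:M -> A *m W *m A = A.
Proof.
by move=> AB BCWA; rewrite -[RHS]mulmx1 -BCWA mulmxDr !mulmxA AB mul0mx add0r.
Qed.

(** * The last invariant factor and torsion *)

Lemma last_nonzero_dvd (s : seq int) :
    sorted dvdz s -> has (fun x => x != 0) s ->
  exists2 i : nat, (i < size s)%N &
    [/\ s`_i = last 0 [seq x <- s | x != 0], s`_i != 0 &
        forall x, x \in s -> x != 0 -> (x %| s`_i)%Z].
Proof.
move=> ss nz; set t := [seq x <- s | x != 0].
have st : sorted dvdz t by apply: sorted_filter ss; exact: dvdz_trans.
have t0 : (0 < size t)%N by rewrite size_filter -has_count.
have lt : last 0 t \in t by rewrite -nth_last mem_nth // prednK.
have /(nthP 0)[i lti si] : last 0 t \in s by move: lt; rewrite mem_filter => /andP[].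
exists i => //; rewrite si; split=> //; first by move: lt; rewrite mem_filter => /andP[].
move=> x xs x0; have /(nthP 0)[j ltj <-] : x \in t by rewrite mem_filter x0.
by rewrite -nth_last; apply: dvdz_nth => //; rewrite -ltnS prednK.
Qed.

(* The last invariant factor is the exponent of the torsion subgroup of the
   cokernel of [N]: [X] shows that it kills the torsion, and [v] is a torsion
   class of exactly that order. *)
Lemma last_inv_factorP k l (N : 'M[int]_(k, l)) : N != 0 ->
  let d := (last_inv_factor N)%:Z in
  [/\ d != 0,
      exists X : 'M[int]_(l, k), N *m X *m N = d *: N &
      exists v : 'cV[int]_k,
        (exists w, d *: v = N *m w) /\
        (forall t w, t *: v = N *m w -> (d %| t)%Z)].
Proof.
have [sz ss [L [R [Lu Ru]]]] := smith_diagP N; rewrite -/(qdiag_mx _ _ (nth 0 _)).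
move=> defN N0 d; rewrite {}/d /last_inv_factor; set s := smith_diag N in sz ss defN *.
set D := qdiag_mx _ _ _ in defN.
have nz : has (fun x => x != 0) s.
  apply: contraNT N0 => /hasPn s0; rewrite defN.
  suff -> : D = 0 by rewrite mulmx0 mul0mx.
  apply/matrixP => i j; rewrite !mxE; case: eqP => // ij.
  have /s0 : s`_i \in s by rewrite mem_nth // sz leq_min ltn_ord ij ltn_ord.
  by rewrite negbK => /eqP->.
have [i lti [<- si0 dvs]] := last_nonzero_dvd ss nz.
set e := s`_i; pose d := `|e|%N%:Z; rewrite -/d.
have d0 : d != 0 by rewrite eqz_nat absz_eq0.
have dvd x : x \in s -> x != 0 -> (x %| d)%Z.
  by move=> xs x0; rewrite dvdzE /= -dvdzE; exact: dvs.
move: lti; rewrite sz leq_min => /andP[ltik ltil].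
split=> //.
  (* This diagonal inverts [D] up to the factor [d], with 0 wherever [D] itself has 0. *)
  pose g a := if s`_a == 0 then 0 else (d %/ s`_a)%Z.
  have DD : D *m qdiag_mx l k g *m D = d *: D.
    rewrite !mul_qdiag_mx; apply/matrixP => a b; rewrite !mxE ltn_ord.
    case: (a =P b :> nat) => [ab|]; last by rewrite mulr0.
    have las : (a < size s)%N by rewrite sz leq_min ltn_ord ab ltn_ord.
    have -> : (a < l)%N by rewrite ab ltn_ord.
    rewrite !mulr1n /g; case: (eqVneq s`_a 0) => [->|sa0].
      by rewrite !mulr0.
    by congr (_ * _); rewrite mulrC divzK // dvd // mem_nth.
  exists (invmx R *m qdiag_mx l k g *m invmx L).
  rewrite defN -!mulmxA mulKmx // mulKVmx // scalemxAr scalemxAl -DD.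
  by rewrite !mulmxA.
(* The column of [L] at the last nonzero invariant factor: coordinate [i] of a relation for it
   yields divisibility by [e]. *)
exists (L *m delta_mx (Ordinal ltik) 0); split.
  exists (invmx R *m delta_mx (Ordinal ltil) (0 : 'I_1) *m (d %/ e)%Z%:M).
  have De : D *m delta_mx (Ordinal ltil) 0 = e *: delta_mx (Ordinal ltik) (0 : 'I_1).
    apply/matrixP => a b; rewrite !mxE (bigD1 (Ordinal ltil)) //= big1 => [|c nc].
      rewrite !mxE eqxx addr0 (ord1 b) eqxx mulr1 andbT -val_eqE /=.
      by case: eqP => [->|]; rewrite ?mulr1 ?mulr0.
    by rewrite !mxE (negPf nc) mulr0.
  rewrite defN -!mulmxA mulKVmx // (mulmxA D) De mul_mx_scalar scalerA.
  by rewrite divzK ?scalemxAr // dvd // mem_nth // sz leq_min ltik.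
move=> t w; rewrite defN scalemxAr -!mulmxA => /(congr1 (mulmx (invmx L))).
rewrite !mulKmx // => /matrixP/(_ (Ordinal ltik) 0).
rewrite !mxE !eqxx mulr1 (bigD1 (Ordinal ltil)) //= big1 => [|c nc].
  rewrite mxE /= eqxx addr0 mulr1n => ->.
  by rewrite dvdzE /= -dvdzE dvdz_mulr.
rewrite mxE /=; case: eqP => [ic|]; last by rewrite mul0r.
by case/eqP: nc; apply/val_inj.
Qed.

(** * Generalized inverses and solvability *)

Lemma scale_int_mx_inj k l (z : int) : z != 0 ->
  injective (fun N : 'M[int]_(k, l) => z *: N).
Proof.
move=> z0 M N /matrixP eMN; apply/matrixP => i j.
by have := eMN i j; rewrite !mxE => /(mulfI z0).
Qed.

Section GeneralizedInverse.

Variables (k l : nat) (A : 'M[int]_(k, l)) (W : 'M[int]_(l, k)).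
Hypothesis AWA : A *m W *m A = A.

(** [A *m W] fixes the columns of [A], hence [z *: v], and the factor [z] cancels over the
    integers. *)
Lemma ginv_saturated p (v : 'M_(k, p)) (z : int) x :
  z != 0 -> z *: v = A *m x -> A *m (W *m v) = v.
Proof.
move=> z0 zv; apply: (scale_int_mx_inj z0).
by rewrite !scalemxAr zv !mulmxA AWA.
Qed.

Lemma ginv_last_inv_factor (c : 'cV[int]_k) (q : nat) :
    A *m (W *m c) != c ->
  (q %| last_inv_factor (row_mx A c))%N
    <-> exists x y, c = A *m x + q%:Z *: y.
Proof.
move=> Wc; set N := row_mx A c.
have NE (w : 'cV_l) (w0 : int) : N *m col_mx w (w0%:M) = A *m w + w0 *: c.
  by rewrite mul_row_col mul_mx_scalar.
have Ndec (u : 'cV_(l + 1)) : N *m u = A *m usubmx u + (dsubmx u 0 0) *: c.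
  by rewrite -NE -mx11_scalar vsubmxK.
have N0 : N != 0.
  apply: contraNneq Wc => /(congr1 rsubmx); rewrite row_mxKr => ->.
  by rewrite linear0 !mulmx0.
have [d0 [X NXN] [v [[w dv] dmin]]] := last_inv_factorP N0.
set d := (last_inv_factor N)%:Z in d0 NXN dv dmin.
rewrite -[(q %| _)%N]/(q%:Z %| d)%Z; split=> [qd|[x [y cE]]]; last first.
  (* Since a multiple of [y] is in the column lattice of [N], [X] puts [d *: y] there too. Comparing
     both expressions sends [(d - q w0) c] into the lattice of [A]; by saturation that coefficient
     is 0. *)
  have qy : q%:Z *: y = N *m col_mx (- x) 1%:M.
    by rewrite NE scale1r mulmxN cE addKr.
  have : q%:Z *: (d *: y) = q%:Z *: (N *m (X *m y)).
    rewrite scalerA mulrC -scalerA qy scalemxAl -NXN !scalemxAr qy.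
    by rewrite !mulmxA.
  rewrite Ndec; set w1 := usubmx _; set w0 := dsubmx _ _ _ => e.
  have {}e : (d - q%:Z * w0) *: c = A *m (q%:Z *: w1 + d *: x).
    have: d *: (q%:Z *: y) = q%:Z *: (A *m w1) + (q%:Z * w0) *: c.
      by rewrite scalerA mulrC -!scalerA -scalerDr.
    have -> : q%:Z *: y = c - A *m x by rewrite cE addrC addKr.
    rewrite scalerBr scalerBl mulmxDr -!scalemxAr => /eqP.
    by rewrite subr_eq => /eqP ->; rewrite addrAC addrK.
  have [/eqP|/ginv_saturated/(_ e)] := eqVneq (d - q%:Z * w0) 0.
    by rewrite subr_eq0 => /eqP->; rewrite dvdz_mulr.
  by move/eqP; rewrite (negPf Wc).
rewrite Ndec in dv; set w1 := usubmx w in dv; set w0 := dsubmx w 0 0 in dv.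
(* Otherwise, as the column lattice of [A] is saturated, [d %/ gcdz w0 d]
   would already kill the class of [v]. *)
have cop : coprimez w0 d.
  pose h := gcdz w0 d.
  have h0 : h != 0 by rewrite gcdz_eq0 negb_and d0 orbT.
  have /dvdzP[d' dE] : (h %| d)%Z by apply: dvdz_gcdr.
  have /dvdzP[w' wE] : (h %| w0)%Z by apply: dvdz_gcdl.
  have hy : h *: (d' *: v - w' *: c) = A *m w1.
    by rewrite scalerBr !scalerA ![h * _]mulrC -dE -wE dv addrK.
  have := ginv_saturated h0 hy; set u := W *m _ => Au.
  have : (d' * h %| d' * 1)%Z.
    rewrite mulr1 -dE; apply: (dmin _ (col_mx u w'%:M)).
    by rewrite NE Au subrK.
  rewrite dvdz_mul2l ?dvdz1 //.
  by apply: contraNneq d0 => d'0; rewrite dE d'0 mul0r.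
case/coprimezP: cop => [[a a'] /= bez].
have /dvdzP[d' dE] := qd.
(* By Bezout [c] is [a w0 c + a' d c], where [w0 c] is [d v - A w1] and [d] is [d' q]. *)
exists (- a *: w1), (d' *: (a *: v + a' *: c)).
rewrite -[LHS]scale1r -bez scalerDl -[(a * w0) *: c]scalerA.
have -> : w0 *: c = d *: v - A *m w1 by rewrite dv addrAC subrr add0r.
rewrite scalerBr scaleNr mulmxN -scalemxAr [q%:Z *: _]scalerA [q%:Z * d']mulrC.
rewrite -dE scalerDr !scalerA.
by rewrite ![d * _]mulrC addrAC addrC.
Qed.

End GeneralizedInverse.

(** * Inclusion-exclusion *)

Lemma sieve_card (T I : finType) (P : pred T) (Z : T -> {set I}) :
  #|[set x | P x && (Z x == finset.set0)]|%:Z =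
  \sum_(S : {set I}) (-1) ^+ #|S| * #|[set x | P x && (S \subset Z x)]|%:Z.
Proof.
have cardE (Q : pred T) : #|[set x | P x && Q x]|%:Z = \sum_(x | P x) (Q x)%:R.
  rewrite -natz -sum1_card natr_sum big_mkcond [RHS]big_mkcond /=.
  by apply: eq_bigr => x _; rewrite inE; case: (P x); case: (Q x).
rewrite (cardE (fun x => Z x == finset.set0)).
under [RHS]eq_bigr do rewrite (cardE (fun x => _ \subset Z x)) mulr_sumr.
rewrite exchange_big /=; apply: eq_bigr => x _.
(* Expanding the product of the factors [1 - [i in Z x]], which is 1 if [Z x] is empty and 0
   otherwise, gives the signed sum over subsets. *)
have := @bigA_distr int 0 1 *%R +%R I (fun i => - (i \in Z x)%:R : int) (fun=> 1).
have -> : \prod_i (- (i \in Z x)%:R + 1) = (Z x == finset.set0)%:R :> int.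
  have [->|/set0Pn[i Zi]] := eqVneq.
    by rewrite big1 // => i _; rewrite inE oppr0 add0r.
  by rewrite (bigD1 i) //= Zi addNr mul0r.
move=> ->; apply: eq_big => // S _; rewrite -big_mkcond /= prodrN.
congr (_ * _).
have [/fintype.subsetP SZ|/subsetPn[i Si Zi]] := boolP (S \subset Z x).
  by rewrite big1 // => i /SZ->.
by rewrite (bigD1 i) //= (negPf Zi) mul0r.
Qed.

(** * Counting solutions modulo [q] *)

Section Reduction.

Variable q : nat.

Lemma redzE (x : int) : (nat_of_ord (redz q x))%:Z = (x %% q.-1.+1)%Z.
Proof.
have x0 : 0 <= (x %% q.-1.+1)%Z by apply: modz_ge0.
by rewrite /= modn_small -?ltz_nat gez0_abs ?ltz_pmod.
Qed.

Lemma redz_eq (x y : int) : (redz q x == redz q y) = (q.-1.+1 %| x - y)%Z.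
Proof. by rewrite -eqz_mod_dvd -!redzE -val_eqE. Qed.

Lemma redz_lift (a : Zmod q) : redz q (nat_of_ord a)%:Z = a.
Proof.
apply/val_inj/eqP; rewrite -eqz_nat redzE modz_nat modn_small //.
Qed.

Fact redzB : zmod_morphism (redz q).
Proof.
have redzD x y : redz q (x + y) = redz q x + redz q y.
  apply/eqP; rewrite -val_eqE -eqz_nat redzE /= -modz_nat PoszD.
  by rewrite !redzE modzDm.
by move=> x y; apply/esym/eqP; rewrite subr_eq -redzD subrK.
Qed.

HB.instance Definition _ := GRing.isZmodMorphism.Build int (Zmod q) (redz q) redzB.

Definition red_cV k (x : 'cV[int]_k) : {ffun 'I_k -> Zmod q} :=
  [ffun i => redz q (x i 0)].

Definition lift_cV k (f : {ffun 'I_k -> Zmod q}) : 'cV[int]_k :=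
  \col_i (nat_of_ord (f i))%:Z.

Lemma lift_cVK k : cancel (@lift_cV k) (@red_cV k).
Proof. by move=> f; apply/ffunP => i; rewrite ffunE mxE redz_lift. Qed.

Hypothesis q_gt0 : (0 < q)%N.

Lemma red_cVP k (x y : 'cV[int]_k) :
  red_cV x = red_cV y <-> exists z, x = y + q%:Z *: z.
Proof.
split=> [/ffunP xy|[z ->]]; last first.
  apply/ffunP => i; rewrite !ffunE !mxE; apply/eqP; rewrite redz_eq prednK //.
  by rewrite addrAC subrr add0r dvdz_mulr.
exists (\col_i ((x i ord0 - y i ord0) %/ q%:Z)%Z).
apply/matrixP => i j; rewrite !mxE (ord1 j).
have /eqP := xy i; rewrite !ffunE redz_eq prednK // => dv.
by rewrite mulrC divzK // addrC subrK.
Qed.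

Lemma red_mulmx k l (N : 'M[int]_(k, l)) (x y : 'cV[int]_l) :
  red_cV x = red_cV y -> red_cV (N *m x) = red_cV (N *m y).
Proof.
by move=> /red_cVP[z ->]; apply/red_cVP; exists (N *m z); rewrite mulmxDr scalemxAr.
Qed.

Lemma red_cVD k (x x' y y' : 'cV[int]_k) :
  red_cV x = red_cV x' -> red_cV y = red_cV y' -> red_cV (x + y) = red_cV (x' + y').
Proof.
move=> /red_cVP[u ->] /red_cVP[v ->]; apply/red_cVP; exists (u + v).
by rewrite scalerDr addrACA.
Qed.

(** From one solution [x0], all arise as [x0 + B h] with [h] modulo [q]: [C] recovers [h], and a
    kernel vector modulo [q] is congruent to an integral one. *)
Lemma card_red_solutions k l d (A : 'M[int]_(k, l)) (B : 'M_(l, d)) C W (c : 'cV_k) :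
    A *m B = 0 -> C *m B = 1%:M -> B *m C + W *m A = 1%:M ->
  #|[set f : {ffun 'I_l -> Zmod q} | red_cV (A *m lift_cV f) == red_cV c]| =
    if `[< exists x y, c = A *m x + q%:Z *: y >] then (q ^ d)%N else 0%N.
Proof.
move=> AB CB BCWA.
have AWA := split_ginv AB BCWA.
case: asboolP => [[x0 [y0 cE]]|no_sol]; last first.
  apply: eq_card0 => f; rewrite inE; apply/negP => /eqP/esym/red_cVP[y cE].
  by apply: no_sol; exists (lift_cV f), y.
pose F (h : {ffun 'I_d -> Zmod q}) := red_cV (x0 + B *m lift_cV h).
have F_inj : injective F.
  move=> h h' Fh; rewrite -[h]lift_cVK -[h']lift_cVK.
  have {}Fh : red_cV (B *m lift_cV h) = red_cV (B *m lift_cV h').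
    have := red_cVD (erefl (red_cV (- x0))) Fh.
    by rewrite !addrA !addNr !add0r.
  by have := red_mulmx C Fh; rewrite !mulmxA CB !mul1mx.
have -> : [set f | red_cV (A *m lift_cV f) == red_cV c]
    = [set F h | h : {ffun 'I_d -> Zmod q}].
  apply/setP => f; rewrite inE; apply/eqP/imsetP => [|[h _ ->]]; last first.
    rewrite (red_mulmx A (lift_cVK _)) mulmxDr mulmxA AB mul0mx addr0.
    by apply/esym/red_cVP; exists y0.
  move=> /red_cVP[y fE].
  set x := lift_cV f in fE; pose u := y + y0.
  have uE : q%:Z *: u = A *m (x - x0).
    by rewrite mulmxBr fE cE scalerDr [RHS]addrAC [A *m x0 + _]addrC addrK addrC.
  have Au := ginv_saturated AWA (_ : q%:Z != 0) uE.
  (* As [u] is in the column lattice, subtracting [q W u] reaches the integral kernel without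
     changing residues. *)
  pose z := x - x0 - q%:Z *: (W *m u).
  have Az : A *m z = 0.
    by rewrite mulmxBr -uE -scalemxAr Au ?subrr // eqz_nat -lt0n.
  exists (red_cV (C *m z)) => //; rewrite -[f]lift_cVK -/x.
  have := red_mulmx B (lift_cVK (red_cV (C *m z))).
  move/(red_cVD (erefl (red_cV x0))); rewrite /F => ->.
  have -> : B *m (C *m z) = z.
    by rewrite -[RHS]mul1mx -BCWA mulmxDl -(mulmxA W) Az mulmx0 addr0 mulmxA.
  by apply/red_cVP; exists (W *m u); rewrite /z [x0 + _]addrC addrAC !subrK.
by rewrite card_imset // card_ffun !card_ord prednK.
Qed.

End Reduction.

(** * Flows with prescribed zeros *)

Lemma map_intr_inj (R : numDomainType) k l :
  injective (map_mx intr : 'M[int]_(k, l) -> 'M[R]_(k, l)).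
Proof.
move=> M N /matrixP MN; apply/matrixP => i j.
by have := MN i j; rewrite !mxE => /intr_inj.
Qed.

Section FlowMatrix.

Variables (n m : nat) (G : multigraph n m).
Implicit Type S : {set 'I_m}.

Lemma leq_num_components T : (num_components G T <= n)%N.
Proof. by rewrite -[X in (_ <= X)%N]card_ord; apply: max_card. Qed.

(** The rank is at most [m], so the subtraction in [nullity] is exact. *)
Lemma mxrank_flow_mx_co_nullity (F : fieldType) S :
  (\rank (map_mx intr (flow_mx G S) : 'M[F]_(_, _)) + co_nullity G S = m)%N.
Proof.
have := mxrank_flow_mx G F S; have := leq_num_components (~: S).
have := rank_leq_col (map_mx intr (flow_mx G S) : 'M[F]_(_, _)).
by have := cardsC S; rewrite card_ord /co_nullity /nullity; lia.
Qed.

Lemma flow_mx_split S :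
  exists (B : 'M[int]_(m, co_nullity G S)) (C : 'M[int]_(co_nullity G S, m))
         (W : 'M[int]_(m, n + #|S|)),
    [/\ flow_mx G S *m B = 0, C *m B = 1%:M & B *m C + W *m flow_mx G S = 1%:M].
Proof.
apply: (constant_rank_split (mxrank_flow_mx_co_nullity rat S)) => F.
by apply/eqP; rewrite -(eqn_add2r (co_nullity G S)) !mxrank_flow_mx_co_nullity.
Qed.

(** Equal rank means that [c] lies in the rational column space of [A], whose vectors [A *m W]
    fixes. The transposes turn columns into the rows that [submx] compares. *)
Lemma rank_int_row_mx k l (A : 'M[int]_(k, l)) W (c : 'cV_k) :
  A *m W *m A = A ->
  (rank_int (row_mx A c) == rank_int A) = (A *m (W *m c) == c).
Proof.
move=> AWA; rewrite /rank_int map_row_mx; set AF := map_mx _ A; set cF := map_mx _ c.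
rewrite -mxrank_tr -[X in _ == X]mxrank_tr tr_row_mx.
have sA : (AF^T <= col_mx AF^T cF^T)%MS by rewrite -addsmxE addsmxSl.
rewrite eq_sym (mxrank_leqif_sup sA) col_mx_sub submx_refl /=.
apply/idP/eqP => [/submxP[x xE]|Ac].
  have {xE}cE : cF = AF *m x^T by rewrite -[LHS]trmxK xE trmx_mul trmxK.
  apply: (@map_intr_inj rat); rewrite !map_mxM /= -/AF -/cF cE !mulmxA.
  by rewrite -!map_mxM AWA.
by rewrite /cF -Ac !map_mxM trmx_mul submxMl.
Qed.

Variable b : 'cV[int]_n.

Let rhs S : 'cV[int]_(n + #|S|) := col_mx b 0.

Lemma bar_mxE S : bar_mx G b S = row_mx (flow_mx G S) (rhs S).
Proof. by rewrite /bar_mx block_mxEh. Qed.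

Lemma rank_condE S (W : 'M_(m, n + #|S|)) :
    flow_mx G S *m W *m flow_mx G S = flow_mx G S ->
  rank_cond G b S = (flow_mx G S *m (W *m rhs S) == rhs S).
Proof.
move=> AWA; rewrite -(rank_int_row_mx (rhs S) AWA) -bar_mxE /rank_cond /rank_int.
by congr (_ == _); rewrite -[X in (X - _)%N](mxrank_flow_mx_co_nullity rat S) addnK.
Qed.

Lemma mul_incidence (x : 'cV[int]_m) v :
  (incidence G *m x) v 0 = \sum_(e | head G e == v) x e 0
                              - \sum_(e | tail G e == v) x e 0.
Proof.
rewrite mxE [X in X - _]big_mkcond [X in _ - X]big_mkcond -sumrB /=.
apply: eq_bigr => e _; rewrite incidenceE.
by case: eqP; case: eqP => _ _; rewrite ?subrr ?subr0 ?sub0r ?mul1r ?mul0r ?mulN1r.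
Qed.

Lemma mul_id_rows S (x : 'cV[int]_m) i : (id_rows S *m x) i 0 = x (enum_val i) 0.
Proof.
rewrite mxE (bigD1 (enum_val i)) //= big1 => [|e ne].
  by rewrite !mxE eqxx mul1r addr0.
by rewrite !mxE eq_sym (negPf ne) mul0r.
Qed.

Lemma flow_mxP q (x : 'cV[int]_m) S :
  (red_cV q (flow_mx G S *m x) == red_cV q (rhs S)) =
  is_flow G (fun v => redz q (b v ord0)) (red_cV q x)
    && (S \subset [set e | red_cV q x e == 0]).
Proof.
have flowE v : redz q ((flow_mx G S *m x) (lshift _ v) 0) =
    \sum_(e | head G e == v) red_cV q x e - \sum_(e | tail G e == v) red_cV q x e.
  rewrite mul_col_mx col_mxEu mul_incidence raddfB !raddf_sum /=.
  by congr (_ + _); apply: eq_bigr => e _; rewrite ffunE.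
have zeroE i : redz q ((flow_mx G S *m x) (rshift _ i) 0) = red_cV q x (enum_val i).
  by rewrite mul_col_mx col_mxEd mul_id_rows ffunE.
apply/eqP/andP => [/ffunP e|[/forallP fl /fintype.subsetP S0]].
  split.
    apply/forallP => v; apply/eqP; rewrite -flowE.
    by have := e (lshift _ v); rewrite !ffunE col_mxEu.
  apply/fintype.subsetP => a aS; rewrite inE -(enum_rankK_in aS aS) -zeroE.
  have := e (rshift _ (enum_rank_in aS a)); rewrite !ffunE col_mxEd => ->.
  by rewrite mxE raddf0.
apply/ffunP => i; rewrite !ffunE; have [v ->|a ->] := split_ordP i.
  by rewrite flowE col_mxEu (eqP (fl v)).
rewrite zeroE col_mxEd mxE raddf0.
by have := S0 _ (enum_valP a); rewrite inE => /eqP.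
Qed.

Lemma card_flows_vanishing q S : (0 < q)%N ->
  #|[set f : {ffun 'I_m -> Zmod q} |
      is_flow G (fun v => redz q (b v ord0)) f && (S \subset [set e | f e == 0])]|
    = (tilde_d G b S q * q ^ co_nullity G S)%N.
Proof.
move=> q0; have [B [C [W [AB CB BCWA]]]] := flow_mx_split S.
have AWA := split_ginv AB BCWA.
under eq_finset => f do rewrite -{1 2}[f]lift_cVK -flow_mxP.
rewrite (card_red_solutions q0 _ AB CB BCWA) /tilde_d (rank_condE AWA).
case: asboolP => [sol|nsol]; case: eqP => [Ac|/eqP Ac].
- by rewrite mul1n.
- by move/(ginv_last_inv_factor AWA q Ac): sol; rewrite -bar_mxE => ->; rewrite mul1n.
(* The rank condition provides the integral solution [W *m rhs S], valid for every modulus. *)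
- by case: nsol; exists (W *m rhs S), 0; rewrite scaler0 addr0.
- case: ifP => //; rewrite bar_mxE => /(ginv_last_inv_factor AWA q Ac).
  by move/nsol.
Qed.

(** When the rank condition fails, the right-hand side is nonzero. Positivity matters because 0
    would be a multiple of every [q]. *)
Lemma last_inv_factor_gt0 S : ~~ rank_cond G b S ->
  (0 < last_inv_factor (bar_mx G b S))%N.
Proof.
have [B [C [W [AB CB BCWA]]]] := flow_mx_split S.
rewrite (rank_condE (split_ginv AB BCWA)) => Ac.
have N0 : bar_mx G b S != 0.
  apply: contraNneq Ac; rewrite bar_mxE => /(congr1 rsubmx); rewrite row_mxKr => ->.
  by rewrite linear0 !mulmx0.
by have [] := last_inv_factorP N0; rewrite eqz_nat lt0n.
Qed.

Lemma tilde_d_large q S : (q_bound G b < q)%N -> tilde_d G b S q = rank_cond G b S.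
Proof.
move=> lt_q; rewrite /tilde_d; case: ifPn => // nc.
rewrite ifF //; apply/negP => /dvdn_leq - /(_ (last_inv_factor_gt0 nc)).
rewrite leqNgt (leq_ltn_trans _ lt_q) //.
exact: (@leq_bigmax_cond _ _ (fun S => last_inv_factor (bar_mx G b S)) S nc).
Qed.

Lemma card_nz_flows q : (0 < q)%N ->
  #|nz_flows G (fun v => redz q (b v ord0))|%:Z =
  \sum_(S : {set 'I_m})
    (-1) ^+ #|S| * (tilde_d G b S q)%:Z * q%:Z ^+ co_nullity G S.
Proof.
move=> q0.
have -> : nz_flows G (fun v => redz q (b v ord0)) =
    [set f | is_flow G (fun v => redz q (b v ord0)) f
             && ([set e | f e == 0] == finset.set0)].
  apply/setP => f; rewrite !inE; congr (_ && _).
  apply/forallP/eqP => [f0|/setP f0 e].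
    by apply/setP => e; rewrite !inE (negPf (f0 e)).
  by have := f0 e; rewrite !inE => ->.
rewrite sieve_card; apply: eq_bigr => S _.
by rewrite card_flows_vanishing // PoszM -mulrA -(natz (q ^ _)) natrX natz.
Qed.

End FlowMatrix.

(** * Flats of the arrangement *)

Section Arrangement.

Variables (R : realType) (n m : nat) (G : multigraph n m) (b : 'cV[int]_n).
Implicit Type S : {set 'I_m}.

Let toR k l (N : 'M[int]_(k, l)) : 'M[R]_(k, l) := map_mx intr N.

Let rhs S : 'cV[int]_(n + #|S|) := col_mx b 0.

Lemma flatE S :
  @flat R n m (incidence G) b S = [set x | toR (flow_mx G S) *m x = toR (rhs S)]%classic.
Proof.
apply/seteqP; split => x /=.
  case=> Mx Hx; rewrite /toR /flow_mx /rhs !map_col_mx mul_col_mx Mx.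
  congr col_mx.
  apply/matrixP => i j; rewrite (ord1 j) map_mx0 mxE [RHS]mxE.
  rewrite (bigD1 (enum_val i)) //= big1 => [|e ne].
    by have [_ ->] := Hx _ (enum_valP i); rewrite mulr0 addr0.
  by rewrite !mxE eq_sym (negPf ne) mul0r.
rewrite /toR /flow_mx /rhs !map_col_mx mul_col_mx => /eq_col_mx[Mx Ix].
split=> // e eS; split=> //.
have /matrixP/(_ (enum_rank_in eS e) 0) := Ix; rewrite map_mx0 mxE [RHS]mxE.
rewrite (bigD1 e) //= big1 => [|e' ne].
  by rewrite !mxE enum_rankK_in // eqxx mul1r addr0.
by rewrite !mxE enum_rankK_in // eq_sym (negPf ne) mul0r.
Qed.

(** Two presentations of an affine subspace differ only in the base point, so the direction is
    determined and [xget] has a single candidate. *)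
Lemma aff_dimE (x : 'cV[R]_m) (U : {vspace 'cV[R]_m}) :
  aff_dim [set x + u | u in [set` U]]%classic = \dim U.
Proof.
apply: xget_unique => [|d [y [V [/seteqP[xUyV yVxU] <-]]]]; first by exists x, U.
suff -> : V = U by [].
have [u0 u0U xu0] : exists2 u0, u0 \in U & x + u0 = y.
  by have [|u uU xu] := yVxU y; [exists 0; rewrite ?addr0 //=; exact: mem0v | exists u].
apply/vspaceP => v; apply/idP/idP => [vV|vU].
  have [|u uU xu] := yVxU (y + v); first by exists v.
  rewrite (_ : v = u - u0) ?rpredB //; apply: (addrI y).
  by rewrite -xu -xu0 [u - u0]addrC addrA addrK.
have [|w wV yw] := xUyV (x + (u0 + v)); first by exists (u0 + v) => //=; rewrite rpredD.
by move: yw; rewrite addrA xu0 => /addrI<-.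
Qed.

(** A real solution [x] gives [A W c = A W A x = c], so real and integral solvability agree; [B]
    spans the real kernel, injectively because of [C]. *)
Lemma flat_dim S :
  `[< @flat R n m (incidence G) b S !=set0 >]%classic = rank_cond G b S
  /\ (rank_cond G b S ->
      aff_dim (@flat R n m (incidence G) b S) = co_nullity G S).
Proof.
have [B [C [W [AB CB BCWA]]]] := flow_mx_split G S.
have AWA := split_ginv AB BCWA.
rewrite (rank_condE _ AWA) flatE; split.
  apply/asboolP/eqP => [[x /= Ax]|Ac].
    apply: (@map_intr_inj R); rewrite !map_mxM -/(toR (rhs S)) -Ax /toR !mulmxA.
    by rewrite -!map_mxM AWA.
  by exists (toR (W *m rhs S)); rewrite /= /toR -map_mxM Ac.
move=> /eqP Ac; set x0 := toR (W *m rhs S).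
have Ax0 : toR (flow_mx G S) *m x0 = toR (rhs S) by rewrite /toR -map_mxM Ac.
pose f := linfun (mulmx (toR B) : 'cV[R]_(co_nullity G S) -> 'cV[R]_m).
have -> : [set x | toR (flow_mx G S) *m x = toR (rhs S)]%classic
    = [set x0 + u | u in [set` limg f]]%classic.
  apply/seteqP; split => x /=.
    move=> Ax; exists (x - x0); last by rewrite addrC subrK.
    have Axx0 : toR (flow_mx G S) *m (x - x0) = 0 by rewrite mulmxBr Ax Ax0 subrr.
    apply/memv_imgP; exists (toR C *m (x - x0)); rewrite ?memvf // lfunE /= mulmxA.
    rewrite -[LHS]mul1mx -(map_mx1 (intr : int -> R)) -BCWA map_mxD !map_mxM /=.
    by rewrite mulmxDl -(mulmxA (map_mx _ W)) -/(toR (flow_mx G S)) Axx0 mulmx0 addr0.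
  case=> u /memv_imgP[v _ ->] <-; rewrite lfunE /= mulmxDr Ax0 mulmxA /toR -map_mxM AB.
  by rewrite map_mx0 mul0mx addr0.
rewrite aff_dimE limg_dim_eq ?dimvf ?dim_matrix; first exact: muln1.
rewrite capfv; apply/eqP/lker0P => u v; rewrite !lfunE /= => /(congr1 (mulmx (toR C))).
by rewrite !mulmxA /toR -map_mxM CB map_mx1 !mul1mx.
Qed.

Lemma char_poly_arrE : char_poly_arr R (incidence G) b =
  \sum_(S : {set 'I_m} | rank_cond G b S) (-1) ^+ #|S| *: 'X^(co_nullity G S).
Proof.
apply: eq_big => [S|S]; have [-> dimS] := flat_dim S; first by [].
by move/dimS->.
Qed.

End Arrangement.

(** * Lifting flows from modulus [q] to [p * q] *)

Lemma nz_flows_lift n m (G : multigraph n m) (b : 'cV[int]_n) (p q : nat) :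
    (0 < p)%N -> (0 < q)%N ->
    (exists f : {ffun 'I_m -> Zmod (p * q)},
       is_flow G (fun v => redz (p * q) (b v ord0)) f) ->
  (#|nz_flows G (fun v => redz q (b v ord0))|
     <= #|nz_flows G (fun v => redz (p * q) (b v ord0))|)%N.
Proof.
move=> p0 q0 [f0 fl0]; have pq0 : (0 < p * q)%N by rewrite muln_gt0 p0.
pose rho (f : {ffun 'I_m -> Zmod (p * q)}) := red_cV q (lift_cV f).
(* It suffices to lift each nowhere-zero flow; a lift has no zeros because 0 reduces to 0. *)
suff sub : nz_flows G (fun v => redz q (b v ord0))
    \subset [set rho f | f in nz_flows G (fun v => redz (p * q) (b v ord0))].
  exact: leq_trans (subset_leq_card sub) (leq_imset_card _ _).
(* With [S] empty only the flow equations remain. *)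
have [B [C [W [AB CB BCWA]]]] := flow_mx_split G finset.set0.
have AWA := split_ginv AB BCWA.
set A := flow_mx G _ in AB BCWA AWA.
pose c := col_mx b 0 : 'cV[int]_(n + #|@finset.set0 'I_m|).
have flowP r (x : 'cV[int]_m) : is_flow G (fun v => redz r (b v ord0)) (red_cV r x)
    = (red_cV r (A *m x) == red_cV r c).
  by rewrite flow_mxP finset.sub0set andbT.
move: fl0; rewrite -[f0]lift_cVK flowP; set x0 := lift_cV f0 => /eqP fl0.
apply/fintype.subsetP => f; rewrite inE -[f]lift_cVK flowP; set x := lift_cV f.
move=> /andP[/eqP fl /forallP nz].
have [y Axx0] : exists y, A *m (x - x0) = q%:Z *: y.
  have [y yE] := (red_cVP q0 _ _).1 fl; have [z zE] := (red_cVP pq0 _ _).1 fl0.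
  exists (y - p%:Z *: z); rewrite mulmxBr yE zE scalerBr scalerA.
  by rewrite opprD addrACA subrr add0r PoszM mulrC.
have Ay : A *m (W *m y) = y.
  by apply: (ginv_saturated AWA _ (esym Axx0)); rewrite eqz_nat -lt0n.
(* The correction keeps [x] modulo [q] and turns [A *m x] into [A *m x0], which meets the flow
   equations modulo [p * q]. *)
pose x1 := x - q%:Z *: (W *m y).
have Ax1 : A *m x1 = A *m x0.
  by rewrite mulmxBr -scalemxAr Ay -Axx0 mulmxBr subKr.
have redx1 : red_cV q x1 = red_cV q x.
  by apply/(red_cVP q0); exists (- (W *m y)); rewrite scalerN.
have rho_x1 : rho (red_cV (p * q) x1) = red_cV q x.
  rewrite -redx1; have [z zE] := (red_cVP pq0 _ _).1 (lift_cVK (red_cV (p * q) x1)).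
  apply/(red_cVP q0); exists (p%:Z *: z); rewrite [lift_cV _]zE.
  by rewrite scalerA PoszM mulrC.
apply/imsetP; exists (red_cV (p * q) x1) => //.
rewrite inE flowP Ax1 fl0 eqxx /=; apply/forallP => e.
apply: contra (nz e) => /eqP e0; rewrite -rho_x1 /rho ffunE mxE e0.
by rewrite (_ : nat_of_ord _ = 0%N) // raddf0.
Qed.

Theorem corollary4p2 (R : realType) (n m : nat) (G : multigraph n m)
    (b : 'cV[int]_n) :
  [/\ forall q : nat, (0 < q)%N ->
        #|nz_flows G (fun v => redz q (b v ord0))|%:Z =
        \sum_(S : {set 'I_m})
          (-1) ^+ #|S| * (tilde_d G b S q)%:Z * q%:Z ^+ co_nullity G S,
      exists tau : {poly int},
        [/\ forall q : nat, (q_bound G b < q)%N ->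
              #|nz_flows G (fun v => redz q (b v ord0))|%:Z = tau.[q%:Z],
            tau = \sum_(S : {set 'I_m} | rank_cond G b S)
                    (-1) ^+ #|S| *: 'X^(co_nullity G S) &
            tau = char_poly_arr R (incidence G) b] &
      forall p q : nat, (0 < p)%N -> (0 < q)%N ->
        (exists f : {ffun 'I_m -> Zmod (p * q)},
           is_flow G (fun v => redz (p * q) (b v ord0)) f) ->
        (#|nz_flows G (fun v => redz q (b v ord0))|
           <= #|nz_flows G (fun v => redz (p * q) (b v ord0))|)%N].
Proof.
split=> [q q0||p q p0 q0]; [exact: card_nz_flows | | exact: nz_flows_lift].
exists (\sum_(S : {set 'I_m} | rank_cond G b S) (-1) ^+ #|S| *: 'X^(co_nullity G S)).
split=> [q lt_q|//|]; last by rewrite char_poly_arrE.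
rewrite card_nz_flows ?(leq_ltn_trans _ lt_q) // horner_sum [RHS]big_mkcond /=.
apply: eq_bigr => S _; rewrite tilde_d_large // hornerZ hornerXn.
by case: ifP => _; rewrite ?mulr1 // mulr0 mul0r.
Qed.
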